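(* Let $K=\mathbb{F}_q$ be a finite field, let $S=K[t_1,\ldots,t_s]$, let $X$ be a subset of $\mathbb{A}^s=K^s$, let $I=I(X)$ be the vanishing ideal of $X$, let $\prec$ be a graded monomial order on $S$, and let $\Delta_\prec^p(I)_d$ be the set of standard monic polynomials of $S/I$ of degree $d$. If $d\geq 2$ and $\delta(C_X(d-1))>1$, then $$ \delta(C_X(d))=\deg(S/I)-\max\{\deg(S/(I,f))\mid f\in\Delta_\prec^p(I)_d\}. $$
   Context: $I(X)$ is the set of all $f\in S$ vanishing at every point of $X$. A monomial order is graded if monomials are first compared by total degree. A standard monomial of $S/I$ is a monomial not in the initial ideal ${\rm in}_\prec(I)$; a standard polynomial of $S/I$ is a nonzero $K$-linear combination of standard monomials; monic means the leading coefficient with respect to $\prec$ is $1$. Write $X=\{P_1,\ldots,P_m\}$ (distinct points), and let $S_{\leq d}$ be the space of polynomials of degree at most $d$. The Reed–Muller-type code of degree $d$ on $X$ is $C_X(d)=\{(f(P_1),\ldots,f(P_m))\mid f\in S_{\leq d}\}\subset K^m$, and $\delta(C)$ denotes the minimum distance of a linear code $C$ (the minimum number of nonzero entries of a nonzero codeword). For an ideal $J\subset S$, let $H_J^a(d)=\dim_K(S_{\leq d}/J_{\leq d})$, with $J_{\leq d}=J\cap S_{\leq d}$. If $J\subsetneq S$ and $k=\dim(S/J)$ (Krull dimension), then for $d\gg0$ $H_J^a(d)$ is a polynomial in $d$ of degree $k$ with leading coefficient $a_k$, and $\deg(S/J)=k!\,a_k$; $\deg(S/J)=0$ if $J=S$.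 In particular, if $k=0$, then $\deg(S/J)=\dim_K(S/J)$. $(I,f)$ is the ideal generated by $I$ and $f$. *)

(* Defs.v *)
From mathcomp Require Import all_boot all_order all_algebra.
From mathcomp Require Import boolp classical_sets.
From mathcomp Require Import mpoly.
Set Implicit Arguments.
Unset Strict Implicit.
Unset Printing Implicit Defensive.
Import Order.TTheory GRing.Theory Num.Theory.
Local Open Scope classical_set_scope.
Local Open Scope ring_scope.

(* [msize f] is 1 + the total degree of [f], and 0 for [f = 0]. *)
Definition polys_le (K : fieldType) (s d : nat) : set {mpoly K[s]} :=
  [set f | (msize f <= d.+1)%N].

Definition vanishing_ideal (K : finFieldType) (s : nat) (X : {set 'rV[K]_s}) :
    set {mpoly K[s]} :=
  [set f | forall P : 'rV[K]_s, P \in X -> f.@[P 0] = 0].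

Definition ideal_gen (R : comNzRingType) (A : set R) : set R :=
  [set g | exists2 r : seq (R * R),
      (forall x, x \in r -> A x.2) & g = \sum_(x <- r) x.1 * x.2].

Definition ideal_adjoin (R : comNzRingType) (J : set R) (f : R) : set R :=
  ideal_gen (J `|` [set f]).

(* [idealr_closed] includes [1 \notin P]. *)
Definition prime_ideal (R : comNzRingType) (P : set R) : Prop :=
  idealr_closed [pred x | x \in P] /\ prime_idealr_closed [pred x | x \in P].

(* The primes of S/J are the primes of S containing J. *)
Definition prime_chain (R : comNzRingType) (J : set R) (k : nat) : Prop :=
  exists P : nat -> set R,
    (forall i, (i <= k)%N -> prime_ideal (P i) /\ J `<=` P i) /\
    (forall i, (i < k)%N -> P i `<` P i.+1).

Definition krull_dim (R : comNzRingType) (J : set R) : nat :=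
  xget 0%N [set k | prime_chain J k /\
                    forall l, prime_chain J l -> (l <= k)%N].

(* The classes of the [b i] form a K-basis of S_{<=d} / J_{<=d}. *)
Definition quotient_basis (K : fieldType) (s : nat) (J : set {mpoly K[s]})
    (d n : nat) (b : 'I_n -> {mpoly K[s]}) : Prop :=
  (forall i, polys_le d (b i)) /\
  (forall f, polys_le d f ->
     exists! c : 'rV[K]_n, J (f - \sum_(i < n) c 0 i *: b i)).

Definition affine_hilbert (K : fieldType) (s : nat) (J : set {mpoly K[s]})
    (d : nat) : nat :=
  xget 0%N [set n | exists b : 'I_n -> {mpoly K[s]}, quotient_basis J d b].

Definition hilbert_poly (K : fieldType) (s : nat) (J : set {mpoly K[s]}) :
    {poly rat} :=
  xget 0 [set h | exists N : nat, forall d : nat, (N <= d)%N ->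
                    (affine_hilbert J d)%:R = h.[d%:R]].

Definition degree (K : fieldType) (s : nat) (J : set {mpoly K[s]}) : rat :=
  if `[< J 1 >] then 0
  else ((krull_dim J)`!)%:R * (hilbert_poly J)`_(krull_dim J).

Definition monomial_order (s : nat) (prec : rel 'X_{1..s}) : Prop :=
  [/\ reflexive prec, antisymmetric prec, transitive prec & total prec] /\
  (forall m m1 m2, prec m1 m2 -> prec (m1 + m)%MM (m2 + m)%MM) /\
  well_founded (fun m1 m2 => prec m1 m2 && (m1 != m2)).

Definition graded (s : nat) (prec : rel 'X_{1..s}) : Prop :=
  forall m1 m2, (mdeg m1 < mdeg m2)%N -> prec m1 m2.

Definition is_lead_monom (K : fieldType) (s : nat) (prec : rel 'X_{1..s})
    (f : {mpoly K[s]}) (m : 'X_{1..s}) : Prop :=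
  m \in msupp f /\ (forall m', m' \in msupp f -> prec m' m).

Definition initial_ideal (K : fieldType) (s : nat) (prec : rel 'X_{1..s})
    (J : set {mpoly K[s]}) : set {mpoly K[s]} :=
  ideal_gen [set g | exists f m,
    [/\ J f, is_lead_monom prec f m & g = 'X_[m]]].

Definition standard_monom (K : fieldType) (s : nat) (prec : rel 'X_{1..s})
    (J : set {mpoly K[s]}) (m : 'X_{1..s}) : Prop :=
  ~ initial_ideal prec J 'X_[m].

Definition standard_poly (K : fieldType) (s : nat) (prec : rel 'X_{1..s})
    (J : set {mpoly K[s]}) (f : {mpoly K[s]}) : Prop :=
  f != 0 /\ (forall m, m \in msupp f -> standard_monom prec J m).

Definition monic_for (K : fieldType) (s : nat) (prec : rel 'X_{1..s})
    (f : {mpoly K[s]}) : Prop :=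
  exists2 m, is_lead_monom prec f m & f@_m = 1.

Definition standard_monic (K : fieldType) (s : nat) (prec : rel 'X_{1..s})
    (J : set {mpoly K[s]}) (d : nat) : set {mpoly K[s]} :=
  [set f | [/\ standard_poly prec J f, monic_for prec f & msize f = d.+1]].

Definition eval_points (K : finFieldType) (s : nat) (X : {set 'rV[K]_s})
    (f : {mpoly K[s]}) : 'rV[K]_#|X| :=
  \row_(i < #|X|) f.@[(enum_val i : 'rV[K]_s) 0].

Definition RM_code (K : finFieldType) (s : nat) (X : {set 'rV[K]_s})
    (d : nat) : set 'rV[K]_#|X| :=
  eval_points X @` polys_le d.
Arguments RM_code {K s} X d _.

Definition hamming_weight (K : fieldType) (m : nat) (c : 'rV[K]_m) : nat :=
  #|[pred i | c 0 i != 0]|.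

(* The value is 0 for the zero code, which for Reed-Muller-type codes occurs
   only when there are no evaluation points. *)
Definition min_distance (K : fieldType) (m : nat) (C : set 'rV[K]_m) : nat :=
  let W := [set w | exists c, [/\ C c, c != 0 & hamming_weight c = w]] in
  xget 0%N [set w | W w /\ forall v, W v -> (w <= v)%N].

Definition is_max (A : set rat) (M : rat) : Prop :=
  A M /\ forall x, A x -> x <= M.

(* Main.v *)
(* Interpolation over the finite field [K] gives [deg (S/I(Y)) = #|Y|] for every
   finite [Y], and [f ^+ (q - 1)] is the indicator function of the nonvanishing
   of [f], so [(I(X), f)] is the vanishing ideal of the zeros of [f] in [X].
   Thus [deg (S/I) - deg (S/(I, f))] is the weight of the codeword of [f].
   Since the order is graded, every codeword of [C_X(d)] comes from a standard
   polynomial of degree at most [d].  The minimum distance strictly decreases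
   from [d - 1] to [d], so a codeword of minimum weight comes from a standard
   polynomial of degree exactly [d]. *)
Require Import Defs.
From mathcomp Require Import all_boot all_order all_algebra.
From mathcomp Require Import boolp classical_sets.
From mathcomp Require Import mpoly.
From mathcomp Require Import finfield.
Set Implicit Arguments.
Unset Strict Implicit.
Unset Printing Implicit Defensive.
Import GRing.Theory Num.Theory.
Local Open Scope classical_set_scope.
Local Open Scope ring_scope.

(** * Vanishing ideals over a finite field and their Krull dimension *)

Lemma expf_card_pred (K : finFieldType) (x : K) :
  x ^+ #|K|.-1 = (x != 0)%:R.
Proof.
have K1 : (1 < #|K|)%N := finNzRing_gt1 K.
have [->|x0] := eqVneq x 0.
  by rewrite expr0n; case: #|K| K1 => [|[|n]].
by apply: (mulfI x0); rewrite -exprS prednK ?(ltnW K1) // expf_card mulr1.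
Qed.

Lemma vanishing_idealMl (K : finFieldType) (s : nat) (Y : {set 'rV[K]_s})
    (f g : {mpoly K[s]}) :
  vanishing_ideal Y g -> vanishing_ideal Y (f * g).
Proof. by move=> hg P PY; rewrite mevalM hg ?mulr0. Qed.

Lemma vanishing_idealN (K : finFieldType) (s : nat) (Y : {set 'rV[K]_s})
    (f : {mpoly K[s]}) :
  vanishing_ideal Y f -> vanishing_ideal Y (- f).
Proof. by move=> hf P PY; rewrite mevalN hf ?oppr0. Qed.

Lemma vanishing_ideal1 (K : finFieldType) (s : nat) (Y : {set 'rV[K]_s}) :
  vanishing_ideal Y 1 <-> Y = finset.set0.
Proof.
split=> [h|->]; last by move=> P; rewrite inE.
apply/eqP; apply: contraT => /set0Pn[P PY].
by have /eqP := h P PY; rewrite meval1 oner_eq0.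
Qed.

Lemma prime_vanishing_ideal1 (K : finFieldType) (s : nat) (P : 'rV[K]_s) :
  prime_ideal (vanishing_ideal [set P]%SET).
Proof.
have vE f : (f \in [pred x | x \in vanishing_ideal [set P]%SET]) =
    (f.@[P 0] == 0).
  rewrite inE; apply/idP/eqP => [/set_mem|h].
    by apply; rewrite inE.
  by apply/mem_set => Q; rewrite inE => /eqP->.
split.
  split; rewrite ?vE ?meval0 ?meval1 ?oner_eq0 // => a u v.
  by rewrite !vE mevalD mevalM => /eqP-> /eqP->; rewrite mulr0 addr0.
by move=> u v; rewrite !vE mevalM mulf_eq0.
Qed.

(* [f ^+ q - f] vanishes everywhere, so modulo a prime containing [I(Y)]
   every polynomial is either 0 or a unit. *)
Lemma prime_over_vanishing_ideal_maximal (K : finFieldType) (s : nat)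
    (Y : {set 'rV[K]_s}) (p q : set {mpoly K[s]}) :
  prime_ideal p -> prime_ideal q -> vanishing_ideal Y `<=` p ->
  p `<=` q -> q `<=` p.
Proof.
move=> [[p0 p1 pD] pM] [[q0 q1 qD] qM] Ip pq f qf.
have inp g : (g \in [pred x | x \in p]) -> p g by move=> h; apply: set_mem.
have pin g : p g -> (g \in [pred x | x \in p]) by move=> h; apply: mem_set.
have qin g : q g -> (g \in [pred x | x \in q]) by move=> h; apply: mem_set.
have K1 : (1 < #|K|)%N := finNzRing_gt1 K.
have K0 : (0 < #|K|.-1)%N by case: #|K| K1 => [|[|]].
have /pin/pM : p (f * (f ^+ #|K|.-1 - 1)).
  apply: Ip => P _.
  by rewrite mulrBr mulr1 -exprS prednK ?(ltnW K1) // mevalB rmorphXn /=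
    expf_card subrr.
case/orP => [/inp //|/inp/pq/qin qu]; case/negP: q1.
(* If the second factor lies in [p], it lies in [q]; as [f] is in [q], so is this combination,
   against the properness of [q]. *)
have -> : 1 = (- 1) * (f ^+ #|K|.-1 - 1) + f ^+ #|K|.-1.
  by rewrite mulN1r opprB subrK.
apply: (qD) => //; rewrite -(prednK K0) exprSr -[X in X \in _]addr0.
exact: qD (qin _ qf) q0.
Qed.

(** A point of [Y] yields a chain of length 0; no chain is longer, because an inclusion of primes
    over [vanishing_ideal Y] is never strict. *)
Lemma krull_dim_vanishing_ideal (K : finFieldType) (s : nat)
    (Y : {set 'rV[K]_s}) :
  Y != finset.set0 -> krull_dim (vanishing_ideal Y) = 0%N.
Proof.
move=> /set0Pn[P PY].
have chain0 l : prime_chain (vanishing_ideal Y) l -> (l <= 0)%N.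
  case: l => // l [p [hp hlt]].
  have [p0 Ip0] := hp 0%N isT; have [p1 _] := hp 1%N isT.
  have [//|sub] := hlt 0%N; case.
  exact: prime_over_vanishing_ideal_maximal p0 p1 Ip0 sub.
rewrite /krull_dim; apply: xget_unique => [|k [/chain0]]; last by case: k.
split=> //; exists (fun _ => vanishing_ideal [set P]%SET); split=> // i _.
split; first exact: prime_vanishing_ideal1.
by move=> f fY Q; rewrite inE => /eqP->; exact: fY.
Qed.

(** * Interpolation, Hilbert function and degree *)

(** A multivariate Lagrange polynomial: at a point, the [i]-th factor is 1 or 0 according as its
    [i]-th coordinate agrees with that of [P] or not. *)
Definition indicator_poly (K : finFieldType) (s : nat) (P : 'rV[K]_s) :
    {mpoly K[s]} :=
  \prod_(i < s) (1 - ('X_i - (P 0 i)%:MP) ^+ #|K|.-1).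

Lemma meval_indicator_poly (K : finFieldType) (s : nat) (P Q : 'rV[K]_s) :
  (indicator_poly P).@[Q 0] = (Q == P)%:R.
Proof.
have E i : (1 - ('X_i - (P 0 i)%:MP) ^+ #|K|.-1).@[Q 0] =
    (Q 0 i == P 0 i)%:R :> K.
  rewrite mevalB meval1 rmorphXn /= mevalB mevalXU mevalC expf_card_pred.
  by rewrite subr_eq0; case: eqP; rewrite ?subr0 ?subrr.
rewrite rmorph_prod /= (eq_bigr _ (fun i _ => E i)).
have [->|QP] := eqVneq Q P; first by rewrite big1 // => i _; rewrite eqxx.
have [i Qi] : exists i, Q 0 i != P 0 i.
  apply/existsP; apply: contraNT QP => /existsPn h.
  by apply/eqP/rowP => i; apply/eqP/negPn/h.
by rewrite (bigD1 i) //= (negPf Qi) mul0r.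
Qed.

(** Since [K] is finite, dimensions can be compared by counting: passing from coordinates in [b] to
    coordinates in [b'] is an injection of [K^m] into [K^n]. *)
Lemma quotient_basis_le (K : finFieldType) (s : nat) (J : set {mpoly K[s]})
    (d m n : nat) (b : 'I_m -> {mpoly K[s]}) (b' : 'I_n -> {mpoly K[s]}) :
  (forall f, J f -> J (- f)) ->
  quotient_basis J d b -> quotient_basis J d b' -> (m <= n)%N.
Proof.
move=> JN [bd bu] [b'd b'u].
have lin k (a : 'I_k -> {mpoly K[s]}) (c : 'rV[K]_k) :
    (forall i, polys_le d (a i)) -> polys_le d (\sum_i c 0 i *: a i).
  move=> ad; apply: leq_trans (msize_sum _ _ _) _.
  apply/bigmax_leqP => i _.
  by apply: leq_trans (msizeZ_le _ _) (ad i).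
have /choice[phi hphi] (c : 'rV[K]_m) : exists c' : 'rV[K]_n,
    J (\sum_i c 0 i *: b i - \sum_i c' 0 i *: b' i).
  by have [c' []] := b'u _ (lin _ _ c bd); exists c'.
suff inj : injective phi.
  have := leq_card phi inj.
  by rewrite !card_mx !mul1n leq_exp2l // finNzRing_gt1.
move=> c1 c2 e.
(* Both [c1] and [c2] are coordinates in [b] of the combination of the [b'] given by [phi c1], so
   uniqueness equates them. *)
have [c [_ cu]] := bu _ (lin _ _ (phi c1) b'd).
rewrite -(cu c1) ?(cu c2) //; first by rewrite e -opprB; apply: JN.
by rewrite -opprB; apply: JN.
Qed.

(** Modulo [vanishing_ideal Y] a polynomial is determined by its values on [Y], and these are its
    coordinates in the indicators. *)
Lemma quotient_basis_indicator_poly (K : finFieldType) (s : nat)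
    (Y : {set 'rV[K]_s}) (d : nat) :
  (forall P : 'rV[K]_s, polys_le d (indicator_poly P)) ->
  quotient_basis (vanishing_ideal Y) d
    (fun i : 'I_#|Y| => indicator_poly (enum_val i)).
Proof.
move=> hd; split=> // f _.
have ev (c : 'rV[K]_#|Y|) i :
    (\sum_j c 0 j *: indicator_poly (enum_val j)).@[(enum_val i : 'rV[K]_s) 0] =
    c 0 i.
  rewrite rmorph_sum /= (bigD1 i) //= mevalZ meval_indicator_poly eqxx mulr1.
  rewrite big1 ?addr0 // => j ji.
  by rewrite mevalZ meval_indicator_poly (inj_eq enum_val_inj) eq_sym
    (negPf ji) mulr0.
exists (\row_i f.@[(enum_val i : 'rV[K]_s) 0]); split.
  move=> P PY; rewrite -(enum_rankK_in PY PY) mevalB ev mxE subrr //.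
move=> c h; apply/rowP => i; rewrite mxE -ev; apply/eqP.
by rewrite -subr_eq0 -mevalB h ?enum_valP.
Qed.

Lemma affine_hilbert_vanishing_ideal (K : finFieldType) (s : nat)
    (Y : {set 'rV[K]_s}) :
  exists N, forall d, (N <= d)%N ->
    affine_hilbert (vanishing_ideal Y) d = #|Y|.
Proof.
exists (\max_(P : 'rV[K]_s) msize (indicator_poly P))%N => d hd.
have qb : quotient_basis (vanishing_ideal Y) d
    (fun i : 'I_#|Y| => indicator_poly (enum_val i)).
  apply: quotient_basis_indicator_poly => P; apply: leqW.
  by apply: leq_trans hd; rewrite (leq_bigmax P).
apply: xget_unique; first by eexists; exact: qb.
move=> n [b hb]; apply/eqP; rewrite eqn_leq.
have N := @vanishing_idealN _ _ Y.
by rewrite (quotient_basis_le N hb qb) (quotient_basis_le N qb hb).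
Qed.

(** The integers from [N] on give [p - q] more roots than its degree allows unless it is zero. *)
Lemma poly_eq_eventually (R : numDomainType) (p q : {poly R}) (N : nat) :
  (forall d : nat, (N <= d)%N -> p.[d%:R] = q.[d%:R]) -> p = q.
Proof.
move=> h; apply/eqP; rewrite -subr_eq0; apply: contraT => nz.
pose rs := [seq i%:R : R | i <- iota N (size (p - q))].
suff : (size rs < size (p - q)%R)%N by rewrite size_map size_iota ltnn.
apply: max_poly_roots => //.
  apply/allP => x /mapP[i]; rewrite mem_iota => /andP[Ni _] ->.
  by rewrite rootE hornerD hornerN h // subrr.
rewrite map_inj_uniq ?iota_uniq // => i j /eqP.
by rewrite eqr_nat => /eqP.
Qed.

Lemma hilbert_poly_vanishing_ideal (K : finFieldType) (s : nat)
    (Y : {set 'rV[K]_s}) :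
  hilbert_poly (vanishing_ideal Y) = (#|Y|%:R)%:P.
Proof.
have [N hN] := affine_hilbert_vanishing_ideal Y.
apply: xget_unique; first by exists N => d Nd; rewrite hN // hornerC.
move=> h [M hM]; apply: (@poly_eq_eventually _ _ _ (maxn N M)) => d.
by rewrite geq_max => /andP[Nd Md]; rewrite -hM // hN // hornerC.
Qed.

Lemma degree_vanishing_ideal (K : finFieldType) (s : nat)
    (Y : {set 'rV[K]_s}) :
  degree (vanishing_ideal Y) = #|Y|%:R.
Proof.
rewrite /degree; case: asboolP => [/vanishing_ideal1 ->|Y1].
  by rewrite cards0.
have Y0 : Y != finset.set0 by apply: contra_notN Y1 => /eqP/vanishing_ideal1.
by rewrite krull_dim_vanishing_ideal // hilbert_poly_vanishing_ideal coefC
  mul1r.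
Qed.

(** * Zeros on [X] and weights of codewords *)

Definition zeros_in (K : finFieldType) (s : nat) (X : {set 'rV[K]_s})
    (f : {mpoly K[s]}) : {set 'rV[K]_s} :=
  [set P in X | f.@[P 0] == 0]%SET.

Lemma ideal_adjoin_vanishing_ideal (K : finFieldType) (s : nat)
    (X : {set 'rV[K]_s}) (f : {mpoly K[s]}) :
  ideal_adjoin (vanishing_ideal X) f = vanishing_ideal (zeros_in X f).
Proof.
apply/seteqP; split=> g.
  move=> [r hr ->] P; rewrite inE => /andP[PX /eqP fP].
  rewrite rmorph_sum big_seq big1 //= => x /hr xr.
  by rewrite mevalM; case: xr => [/(_ P PX)->|->]; rewrite ?fP mulr0.
move=> hg; have K1 : (1 < #|K|)%N := finNzRing_gt1 K.
(* The first term vanishes on [X]: [g] does so at the zeros of [f], and [1 - f ^+ #|K|.-1] at the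
   other points. *)
exists [:: (1, g * (1 - f ^+ #|K|.-1)); (g * f ^+ #|K|.-2, f)].
  move=> x; rewrite !inE => /orP[]/eqP->; last by right.
  left=> P PX; rewrite mevalM mevalB meval1 rmorphXn /= expf_card_pred.
  have [fP|fP] := eqVneq; last by rewrite subrr mulr0.
  by rewrite hg ?mul0r // inE PX fP eqxx.
rewrite !big_cons big_nil addr0 /= mul1r -mulrA -exprSr.
have -> : (#|K|.-2.+1 = #|K|.-1)%N by case: #|K| K1 => [|[|]].
by rewrite -mulrDr subrK mulr1.
Qed.

Lemma card_zeros_in (K : finFieldType) (s : nat) (X : {set 'rV[K]_s})
    (f : {mpoly K[s]}) :
  (hamming_weight (eval_points X f) + #|zeros_in X f|)%N = #|X|.
Proof.
rewrite -[RHS](cardsID [set P : 'rV[K]_s | f.@[P 0] == 0]%SET X) addnC.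
congr addn; first by apply: eq_card => P; rewrite !inE.
rewrite /hamming_weight -(card_imset _ (@enum_val_inj _ (mem X))).
apply: eq_card => P; rewrite !inE; apply/imsetP/andP.
  by move=> [i]; rewrite inE mxE => fi ->; rewrite enum_valP.
move=> [fP PX]; exists (enum_rank_in PX P); last by rewrite enum_rankK_in.
by rewrite inE mxE enum_rankK_in.
Qed.

Lemma eval_points_eq0 (K : finFieldType) (s : nat) (X : {set 'rV[K]_s})
    (f : {mpoly K[s]}) :
  eval_points X f = 0 <-> vanishing_ideal X f.
Proof.
split=> [/rowP e P PX|h].
  by have := e (enum_rank_in PX P); rewrite !mxE enum_rankK_in.
by apply/rowP => i; rewrite !mxE h ?enum_valP.
Qed.

Lemma eval_points_congr (K : finFieldType) (s : nat) (X : {set 'rV[K]_s})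
    (f g : {mpoly K[s]}) :
  vanishing_ideal X (f - g) -> eval_points X f = eval_points X g.
Proof.
move=> h; apply/rowP => i; rewrite !mxE; apply/eqP.
by rewrite -subr_eq0 -mevalB h ?enum_valP.
Qed.

Lemma hamming_weight_evalZ (K : finFieldType) (s : nat) (X : {set 'rV[K]_s})
    (c : K) (f : {mpoly K[s]}) :
  c != 0 ->
  hamming_weight (eval_points X (c *: f)) = hamming_weight (eval_points X f).
Proof.
by move=> c0; apply: eq_card => i; rewrite !inE !mxE mevalZ mulf_eq0 negb_or c0.
Qed.

(** * Minimum distance *)

Lemma min_distance_le (K : fieldType) (m : nat) (C : set 'rV[K]_m)
    (c : 'rV[K]_m) :
  C c -> c != 0 -> (min_distance C <= hamming_weight c)%N.
Proof.
move=> Cc c0; rewrite /min_distance; case: xgetP => // w _ [_]; apply.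
by exists c.
Qed.

Lemma min_distance_attained (K : fieldType) (m : nat) (C : set 'rV[K]_m)
    (c0 : 'rV[K]_m) :
  C c0 -> c0 != 0 ->
  exists c, [/\ C c, c != 0 & hamming_weight c = min_distance C].
Proof.
move=> Cc0 nz.
pose W w := `[< exists c, [/\ C c, c != 0 & hamming_weight c = w] >].
have exW : exists w, W w.
  by exists (hamming_weight c0); apply/asboolP; exists c0.
have [w /asboolP Ww minw] := ex_minnP exW.
rewrite /min_distance; case: xgetP => [v _ [] // | /(_ w)[]].
by split=> // v Wv; apply: minw; apply/asboolP.
Qed.

(** The default value in [min_distance] is 0, so a positive value must be the weight of an actual
    nonzero codeword. *)
Lemma min_distance_gt0 (K : fieldType) (m : nat) (C : set 'rV[K]_m) :
  (0 < min_distance C)%N -> exists2 c, C c & c != 0.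
Proof.
rewrite /min_distance; case: xgetP => // w _ [[c [Cc nz _]] _] _.
by exists c.
Qed.

Lemma RM_code_le (K : finFieldType) (s : nat) (X : {set 'rV[K]_s}) (d e : nat) :
  (d <= e)%N -> RM_code X d `<=` RM_code X e.
Proof.
by move=> de _ [f fd <-]; exists f => //; apply: leq_trans fd _; rewrite ltnS.
Qed.

(* If [f] is nonzero at the distinct points [P] and [Q] of [X], then for some
   [i] the polynomial [('X_i - P_i) * f] vanishes at [P] but not at [Q]. *)
Lemma min_distance_RM_decreasing (K : finFieldType) (s : nat)
    (X : {set 'rV[K]_s}) (d : nat) :
  (1 < min_distance (RM_code X d))%N ->
  (min_distance (RM_code X d.+1) < min_distance (RM_code X d))%N.
Proof.
move=> gt1.
have [c0 Cc0 nz0] := min_distance_gt0 (ltnW gt1).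
have [_ [[f fd <-] nz hw]] := min_distance_attained Cc0 nz0.
rewrite -hw in gt1 *; have /card_gt1P[i [j [fi fj ij]]] := gt1.
rewrite !inE !mxE in fi fj.
pose P : 'rV[K]_s := enum_val i; pose Q : 'rV[K]_s := enum_val j.
have [k Pk] : exists k, Q 0 k != P 0 k.
  apply/existsP; apply: contraNT ij => /existsPn h.
  by rewrite eq_sym; apply/eqP/enum_val_inj/rowP => k; apply/eqP/negPn/h.
pose l : {mpoly K[s]} := 'X_k - (P 0 k)%:MP.
have lE (T : 'rV[K]_s) : (l * f).@[T 0] = (T 0 k - P 0 k) * f.@[T 0].
  by rewrite mevalM mevalB mevalXU mevalC.
apply: leq_ltn_trans (@min_distance_le _ _ _ (eval_points X (l * f)) _ _) _.
- exists (l * f) => //; rewrite /polys_le /=.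
  have l2 : (msize l <= 2)%N.
    rewrite (leq_trans (msizeD_le _ _)) // msizeN geq_max msizeX mdeg1 /=.
    by rewrite msizeC; case: (_ != _).
  have [->|] := eqVneq (l * f) 0; first by rewrite msize0.
  rewrite mulf_eq0 negb_or => /andP[l0 f0].
  (* Sizes exceed degrees by one, so the product has size at most [2 + d.+1 - 1], that is [d.+2]. *)
  by rewrite msizeM // -subn1 leq_subLR (leq_trans (leq_add l2 fd)).
- apply: contraNneq fj => /rowP/(_ j); rewrite !mxE lE => /eqP.
  by rewrite mulf_eq0 subr_eq0 (negPf Pk).
(* The support of the new codeword lies in that of [f] and misses [i]. *)
- apply: proper_card; apply/properP; split.
    apply/fintype.subsetP => x; rewrite !inE !mxE lE mulf_eq0 negb_or.
    by case/andP.
  by exists i; rewrite !inE !mxE // lE subrr mul0r eqxx.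
Qed.

(** * Reduction to standard polynomials *)

Lemma graded_mdeg_le (s : nat) (prec : rel 'X_{1..s}) (m m' : 'X_{1..s}) :
  monomial_order prec -> graded prec -> prec m' m -> (mdeg m' <= mdeg m)%N.
Proof.
move=> [[_ anti _ _] _] gr mm; rewrite leqNgt; apply/negP => lt.
have e : m = m' by apply: anti; rewrite mm gr.
by rewrite e ltnn in lt.
Qed.

Lemma lead_monom_exists (K : fieldType) (s : nat) (prec : rel 'X_{1..s})
    (f : {mpoly K[s]}) :
  monomial_order prec -> f != 0 -> exists m, is_lead_monom prec f m.
Proof.
move=> [[refl anti tr tot] _]; rewrite -msupp_eq0 => f0.
suff [m ms mmax] : exists2 m, m \in msupp f &
    forall m', m' \in msupp f -> prec m' m.
  by exists m.
elim: (msupp f) f0 => // a r IH _; have [r0|r0] := eqVneq r [::].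
  by exists a => [|m']; rewrite r0 inE ?mem_head // => /eqP->; apply: refl.
have [m mr mmax] := IH r0; have /orP[am|ma] := tot a m.
  by exists m => [|m']; rewrite inE ?mr ?orbT // => /predU1P[->|/mmax].
exists a => [|m']; rewrite inE ?eqxx // => /predU1P[->|/mmax h].
  exact: refl.
exact: tr ma.
Qed.

(** Comparing coefficients of [m], some generating leading monomial divides [m]; multiplying its
    polynomial by the quotient monomial moves the leading monomial to [m]. *)
Lemma initial_ideal_lead_monom (K : fieldType) (s : nat)
    (prec : rel 'X_{1..s}) (J : set {mpoly K[s]}) (m : 'X_{1..s}) :
  monomial_order prec -> (forall f g, J g -> J (f * g)) ->
  initial_ideal prec J 'X_[m] -> exists2 h, J h & is_lead_monom prec h m.
Proof.
move=> [_ [padd _]] JM [r hr e].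
have [x xr xm] : exists2 x, x \in r & (x.1 * x.2)@_m != 0.
  have := oner_neq0 K; rewrite -[1]/(true%:R) -(eqxx m) -mcoeffX e.
  rewrite raddf_sum; case: (altP (@allP _ (fun x => (x.1 * x.2)@_m == 0) r)).
    by move=> h; rewrite big_seq big1 ?eqxx // => x /h/eqP.
  by move=> /allPn[x xr xm] _; exists x.
have [h [l [Jh [lh lmax] x2]]] := hr _ xr.
move: xm; rewrite x2 -mcoeff_msupp (perm_mem (msuppMX _ _)) => /mapP[k _ mE].
exists (h * 'X_[k]); first by rewrite mulrC; apply: JM.
split; rewrite ?(perm_mem (msuppMX _ _)).
  by apply/mapP; exists l; rewrite // mE addmC.
move=> m'; rewrite (perm_mem (msuppMX _ _)) => /mapP[l' l'h ->].
by rewrite mE addmC; apply/padd/lmax.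
Qed.

(** The shape of a remainder of ['X_[m]]; for a graded order the bound by [m] also controls its
    degree. *)
Definition standard_below (K : fieldType) (s : nat) (prec : rel 'X_{1..s})
    (J : set {mpoly K[s]}) (m : 'X_{1..s}) (g : {mpoly K[s]}) : Prop :=
  forall m', m' \in msupp g -> standard_monom prec J m' /\ prec m' m.

Lemma standard_below_sum (K : fieldType) (s : nat) (prec : rel 'X_{1..s})
    (J : set {mpoly K[s]}) (m : 'X_{1..s}) (I : eqType) (r : seq I) (a : I -> K)
    (F : I -> {mpoly K[s]}) :
  (forall i, i \in r -> standard_below prec J m (F i)) ->
  standard_below prec J m (\sum_(i <- r) a i *: F i).
Proof.
move=> h m' /msupp_sum_le; rewrite filter_predT => /flattenP[_ /mapP[i ir ->]].
by move=> /msuppZ_le; apply: h.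
Qed.

(* Well-founded induction on [m]: if [m] is not standard, it is the leading
   monomial of some [h] in [J], so [m] is congruent to a combination of smaller
   monomials. *)
Lemma monom_reduction (K : finFieldType) (s : nat) (prec : rel 'X_{1..s})
    (X : {set 'rV[K]_s}) (m : 'X_{1..s}) :
  monomial_order prec ->
  exists2 g, vanishing_ideal X ('X_[m] - g) &
    standard_below prec (vanishing_ideal X) m g.
Proof.
move=> po; have [[refl anti tr _] [_ wf]] := po.
elim/(well_founded_ind wf): m => m IH.
have [std|/contrapT nstd] :=
  pselect (standard_monom prec (vanishing_ideal X) m).
  exists 'X_[m]; first by move=> P _; rewrite subrr meval0.
  by move=> m'; rewrite msuppX inE => /eqP->.
have [h hI [mh hmax]] := initial_ideal_lead_monom po
  (fun f g => @vanishing_idealMl _ _ X f g) nstd.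
have hm0 : h@_m != 0 by rewrite -mcoeff_msupp.
(* The implication makes [F] total: monomials not strictly below [m] get the irrelevant value 0. *)
have /choice[F hF] (m' : 'X_{1..s}) : exists g,
    prec m' m && (m' != m) -> vanishing_ideal X ('X_[m'] - g) /\
    standard_below prec (vanishing_ideal X) m' g.
  have [/IH[g g1 g2]|] := boolP (prec m' m && (m' != m)); first by exists g.
  by exists 0.
pose r := [seq m' <- msupp h | m' != m].
have hr m' : m' \in r -> prec m' m && (m' != m).
  by rewrite mem_filter => /andP[-> /hmax->].
(* Solve [h = 0] for ['X_[m]] modulo the ideal, then replace each lower monomial by its
   remainder. *)
exists (\sum_(m' <- r) (- (h@_m)^-1 * h@_m') *: F m'); last first.
  apply: standard_below_sum => m' /hr lt m'' /(hF m' lt).2[std le].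
  by split=> //; apply: tr le _; case/andP: lt.
have hE : h = h@_m *: 'X_[m] + \sum_(m' <- r) h@_m' *: 'X_[m'].
  by rewrite {1}[h]mpolyE (bigD1_seq m) ?msupp_uniq //= big_filter.
have -> : 'X_[m] - \sum_(m' <- r) (- (h@_m)^-1 * h@_m') *: F m' =
    (h@_m)^-1 *: h -
    \sum_(m' <- r) ((h@_m)^-1 * h@_m') *: ('X_[m'] - F m').
  rewrite [X in _ *: X - _]hE scalerDr scalerA mulVf // scale1r -addrA.
  congr (_ + _).
  rewrite scaler_sumr -sumrN -sumrB; apply: eq_bigr => m' _.
  by rewrite scalerA mulNr scaleNr opprK scalerBr opprB addrC subrK.
move=> P PX; rewrite mevalB mevalZ hI // mulr0 rmorph_sum /= big_seq big1.
  by rewrite subrr.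
by move=> m' /hr/hF[/(_ P PX) e _]; rewrite mevalZ e mulr0.
Qed.

(** Reduce each monomial of [f] and recombine linearly; gradedness prevents the degree from
    growing. *)
Lemma standard_reduction (K : finFieldType) (s : nat) (prec : rel 'X_{1..s})
    (X : {set 'rV[K]_s}) (f : {mpoly K[s]}) :
  monomial_order prec -> graded prec ->
  exists g, [/\ vanishing_ideal X (f - g), (msize g <= msize f)%N &
    forall m, m \in msupp g -> standard_monom prec (vanishing_ideal X) m].
Proof.
move=> po gr.
have /choice[F hF] (m : 'X_{1..s}) : exists g,
    vanishing_ideal X ('X_[m] - g) /\
    standard_below prec (vanishing_ideal X) m g.
  by have [g] := monom_reduction X m po; exists g.
exists (\sum_(m <- msupp f) f@_m *: F m).
have supp m' : m' \in msupp (\sum_(m <- msupp f) f@_m *: F m) ->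
    exists2 m, m \in msupp f &
      standard_monom prec (vanishing_ideal X) m' /\ prec m' m.
  move/msupp_sum_le; rewrite filter_predT => /flattenP[_ /mapP[m mf ->]].
  by move=> /msuppZ_le/((hF m).2 m'); exists m.
split.
- move=> P PX; rewrite {1}[f]mpolyE -sumrB rmorph_sum /= big1 // => m _.
  by rewrite -scalerBr mevalZ (hF m).1 // mulr0.
- rewrite [leqLHS]msizeE; apply/bigmax_leqP_seq => m' /supp[m mf [_ le]] _.
  exact: leq_ltn_trans (graded_mdeg_le po gr le) (msize_mdeg_lt mf).
- by move=> m /supp[? _ []].
Qed.

(** Otherwise the leading monomial of [f] would be a generator of the initial ideal. *)
Lemma standard_poly_notin (K : fieldType) (s : nat) (prec : rel 'X_{1..s})
    (J : set {mpoly K[s]}) (f : {mpoly K[s]}) :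
  monomial_order prec -> standard_poly prec J f -> ~ J f.
Proof.
move=> po [f0 std] Jf; have [m lm] := lead_monom_exists po f0.
apply: (std m lm.1); exists [:: (1, 'X_[m])]; last by rewrite big_seq1 mul1r.
by move=> x; rewrite inE => /eqP->; exists f, m.
Qed.

(** * The maximum read off from a codeword of minimum weight *)

Unset Implicit Arguments.

Theorem corollary3p7 (K : finFieldType) (s : nat) (X : {set 'rV[K]_s})
    (prec : rel 'X_{1..s}) (d : nat)
    (prec_order : monomial_order prec) (prec_graded : graded prec)
    (d_ge2 : (2 <= d)%N)
    (dist_gt1 : (1 < min_distance (RM_code X d.-1))%N) :
  exists M : rat,
    is_max ((fun f => degree (ideal_adjoin (vanishing_ideal X) f)) @`
              standard_monic prec (vanishing_ideal X) d) M /\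
    (min_distance (RM_code X d))%:R = degree (vanishing_ideal X) - M.
Proof.
have d_gt0 : (0 < d)%N := ltnW d_ge2.
have lt := min_distance_RM_decreasing dist_gt1.
rewrite prednK // in lt.
have [c0 /(RM_code_le (leq_pred d)) Cc0 nz0] :=
  min_distance_gt0 (ltnW dist_gt1).
have [_ [[f fd <-] nz hw]] := min_distance_attained Cc0 nz0.
have [g [fg gf gstd]] := standard_reduction X f prec_order prec_graded.
rewrite (eval_points_congr fg) in nz hw.
(* In lower degree, the codeword of [g] would lie in [RM_code X d.-1] with weight below its minimum
   distance. *)
have gsize : msize g = d.+1.
  apply/eqP; rewrite eqn_leq (leq_trans gf fd) /= ltnNge; apply/negP => gd.
  have := @min_distance_le _ _ (RM_code X d.-1) (eval_points X g) _ nz.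
  rewrite hw leqNgt lt => /(_ _)/notF; apply.
  by exists g => //; rewrite /polys_le /= prednK.
have g0 : g != 0 by rewrite -msize_poly_eq0 gsize.
have [m [mg mmax]] := lead_monom_exists prec_order g0.
have gm0 : g@_m != 0 by rewrite -mcoeff_msupp.
have u0 : (g@_m)^-1 != 0 by rewrite invr_eq0.
(* Scaling makes [g] monic without changing its support or the weight of its codeword. *)
pose h := (g@_m)^-1 *: g.
have hsupp : msupp h =i msupp g by apply/perm_mem/msuppZ.
have hstd : standard_monic prec (vanishing_ideal X) d h.
  split; last by rewrite msizeZ.
    by split=> [|m']; rewrite ?scaler_eq0 ?negb_or ?u0 // hsupp; apply: gstd.
  exists m; last by rewrite mcoeffZ mulVf.
  by split=> [|m']; rewrite hsupp //; apply: mmax.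
have degE f' : degree (ideal_adjoin (vanishing_ideal X) f') =
    #|X|%:R - (hamming_weight (eval_points X f'))%:R.
  rewrite ideal_adjoin_vanishing_ideal degree_vanishing_ideal.
  by rewrite -[X in _ = X%:R - _](card_zeros_in X f') natrD addrAC subrr add0r.
exists (degree (ideal_adjoin (vanishing_ideal X) h)); split; last first.
  by rewrite degE degree_vanishing_ideal subKr hamming_weight_evalZ // hw.
split; first by exists h.
(* Degrees fall as weights rise, so it suffices that the codeword of [f'] is nonzero and hence has
   at least minimum weight. *)
move=> _ [f' [f'std _ f'd] <-]; rewrite !degE lerB // ler_nat.
rewrite hamming_weight_evalZ // hw; apply: min_distance_le.
  by exists f' => //; rewrite /polys_le /= f'd.
apply/eqP => /eval_points_eq0; exact: standard_poly_notin f'std.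
Qed.
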